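(* Let $X_0\in\mathcal M_{p,q}(\mathbf R_+)$ have at least one positive entry on each row and on each column. 1. (Case of incompatibility) The set $\Gamma(X_0)$ is empty if and only if there exist two subsets $A\subset\{1,\dots,p\}$ and $B\subset\{1,\dots,q\}$ such that $X_0$ is null on $A\times B$ and $a(A)>b(B^c)$. 2. (Critical case) Assume now that $\Gamma(X_0)$ is not empty. Then: (a) There exists a matrix $S_0\in\Gamma(X_0)$ whose support contains the support of every matrix in $\Gamma(X_0)$. (b) The support of $S_0$ is strictly contained in $\mathrm{Supp}(X_0)$ if and only if there exist two non-empty subsets $A\subset\{1,\dots,p\}$ and $B\subset\{1,\dots,q\}$ such that $X_0$ is null on $A\times B$ and $a(A)=b(B^c)$. (c) More precisely, the support of $S_0$ is the complement in $\mathrm{Supp}(X_0)$ of the union of all products $A^c\times B^c$ over all non-empty subsets $A\times B$ of $\{1,\dots,p\}\times\{1,\dots,q\}$ such that $X_0$ is null on $A\times B$ and $a(A)=b(B^c)$.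
   Context: Fix integers $p,q\ge 2$ and vectors $a=(a_1,\dots,a_p)$, $b=(b_1,\dots,b_q)$ with positive components such that $\sum_i a_i=\sum_j b_j=1$. For $A\subset\{1,\dots,p\}$ and $B\subset\{1,\dots,q\}$ set $a(A)=\sum_{i\in A}a_i$, $b(B)=\sum_{j\in B}b_j$, $A^c=\{1,\dots,p\}\setminus A$, $B^c=\{1,\dots,q\}\setminus B$. $\mathcal M_{p,q}(\mathbf R_+)$ is the set of $p\times q$ matrices with non-negative entries. The support of $X\in\mathcal M_{p,q}(\mathbf R_+)$ is $\mathrm{Supp}(X)=\{(i,j):X(i,j)>0\}$. $\Gamma=\Gamma(a,b)$ is the set of all $X\in\mathcal M_{p,q}(\mathbf R_+)$ with $\sum_{j}X(i,j)=a_i$ for all $i$ and $\sum_i X(i,j)=b_j$ for all $j$, and $\Gamma(X_0)=\{S\in\Gamma:\mathrm{Supp}(S)\subset\mathrm{Supp}(X_0)\}$. ''$X_0$ is null on $A\times B$'' means $X_0(i,j)=0$ for all $(i,j)\in A\times B$.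
   Formalization: In 2(b) the pair A, B is also required to be such that X_0 is not null on A^c×B^c; without this the ''if'' direction fails, e.g. for the 2×2 identity matrix with a=b=(1/2,1/2), A={1}, B={2}. *)

(* Defs.v *)
From mathcomp Require Import all_boot all_order all_algebra.
From mathcomp Require Import boolp classical_sets reals.

Set Implicit Arguments.
Unset Strict Implicit.
Unset Printing Implicit Defensive.

Import Order.TTheory GRing.Theory Num.Theory.
Local Open Scope ring_scope.

Section Transport.
Context {R : realType} {p q : nat}.
Implicit Types (X S : 'M[R]_(p, q)) (a : 'rV[R]_p) (b : 'rV[R]_q).
Implicit Types (A : {set 'I_p}) (B : {set 'I_q}).

Definition nonneg_mx X : Prop := forall i j, 0 <= X i j.

Definition Supp X : {set 'I_p * 'I_q} := [set ij | 0 < X ij.1 ij.2].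

Definition Gamma a b : set 'M[R]_(p, q) := fun X =>
  [/\ nonneg_mx X,
      forall i, \sum_(j < q) X i j = a 0 i
    & forall j, \sum_(i < p) X i j = b 0 j].

Definition GammaS a b X0 : set 'M[R]_(p, q) := fun S =>
  Gamma a b S /\ Supp S \subset Supp X0.

Definition null_on X A B : bool := [forall i in A, forall j in B, X i j == 0].

(* In the equality case of the margin condition, every matrix of [GammaS a b X]
   vanishes on [~: A] x [~: B].  This removes something from the support of [X]
   only if [X] is not already null there: for the 2 x 2 identity matrix and
   uniform margins, ({0}, {1}) is critical although X/2 has these margins and
   the same support as X. *)
Definition critical a b X A B : bool :=
  [&& A != finset.set0, B != finset.set0, null_on X A B
    & (\sum_(i in A) a 0 i == \sum_(j in ~: B) b 0 j)].

Definition max_support a b X0 S0 : Prop :=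
  GammaS a b X0 S0 /\ (forall S, GammaS a b X0 S -> Supp S \subset Supp S0).

End Transport.

(* Main.v *)
Require Import Defs.
From mathcomp Require Import all_boot all_order all_algebra.
From mathcomp Require Import boolp classical_sets reals.
From mathcomp Require Import lra.

(** Regard the support of [X0] as a bipartite graph between rows and columns,
and define the slack of a pair (A, B) as b(~: B) - a(A).  If [S] has the right
margins and [X0] is null on A x B, then the slack of (A, B) is exactly the mass
that [S] gives to [~: A] x [~: B] ([slack_plan]).  Hence the slacks of the null
pairs are nonnegative as soon as [GammaS] is inhabited, and when such a slack
is zero every matrix in [GammaS] vanishes on [~: A] x [~: B].

The converse is a transportation version of Hall's theorem, which is proved by
peeling off edges.  Take an edge (i0, j0), let t be the least slack of a null
pair (A, B) such that (i0, j0) lies in [~: A] x [~: B], put mass t on the edge,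
subtract t from the two margins it meets and delete the edge.  The slack is
modular, so the smaller problem still satisfies the cut condition
([cut_condition_peel]), and induction on the number of edges builds a plan
([plan_exists]).

The same construction gives more: an edge can be the first one to be peeled,
and then it carries at least t ([plan_charging]).  So an edge of [X0] either is
in the support of some matrix of [GammaS], or has t = 0; in the latter case the
pair that attains the minimum is critical, because positive margins exclude
empty A or B ([Supp_critical]).  This gives the description of the largest
support, which exists because the midpoint of two matrices has the union of
their supports. *)

Set Implicit Arguments.
Unset Strict Implicit.
Unset Printing Implicit Defensive.

Import Order.TTheory GRing.Theory Num.Theory.
Local Open Scope ring_scope.

(** * Transport plans on a bipartite graph *)

Section Plans.
Context {R : realDomainType} {I J : finType}.
Implicit Types (E : {set I * J}) (A : {set I}) (B : {set J}).
Implicit Types (a : I -> R) (b : J -> R) (S : I -> J -> R).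

Definition edgeless E A B : bool :=
  [forall i in A, forall j in B, (i, j) \notin E].

Lemma edgelessP E A B :
  reflect (forall i j, i \in A -> j \in B -> (i, j) \notin E) (edgeless E A B).
Proof.
apply: (iffP forall_inP) => [H i j iA jB | H i iA].
  by have /forall_inP := H i iA; exact.
by apply/forall_inP => j; exact: H.
Qed.

Definition slack a b A B : R := \sum_(j in ~: B) b j - \sum_(i in A) a i.

Definition cut_condition E a b : Prop :=
  forall A B, edgeless E A B -> 0 <= slack a b A B.

Definition plan E a b S : Prop :=
  [/\ forall i j, 0 <= S i j,
      forall i j, (i, j) \notin E -> S i j = 0,
      forall i, \sum_j S i j = a i
    & forall j, \sum_i S i j = b j].

(** All the mass of the rows of [A] goes to the columns of [~: B]; what these
columns still have to receive comes from the rows of [~: A]. *)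
Lemma slack_plan E a b S A B : plan E a b S -> edgeless E A B ->
  slack a b A B = \sum_(i in ~: A) \sum_(j in ~: B) S i j.
Proof.
move=> [_ S0 Sa Sb] /edgelessP AB0; rewrite /slack.
have -> : \sum_(i in A) a i = \sum_(i in A) \sum_(j in ~: B) S i j.
  apply: eq_bigr => i iA; rewrite -Sa (bigID (mem (~: B))) /=.
  rewrite [X in _ + X]big1 ?addr0 // => j; rewrite inE negbK => jB.
  exact/S0/AB0.
have -> : \sum_(j in ~: B) b j = \sum_i \sum_(j in ~: B) S i j.
  by rewrite exchange_big /=; apply: eq_bigr => j _; rewrite Sb.
rewrite [X in X - _](bigID (mem A)) /= addrAC subrr add0r.
by apply: eq_bigl => i; rewrite inE.
Qed.

Lemma slack_ge0 E a b S : plan E a b S -> cut_condition E a b.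
Proof.
move=> planS A B /(slack_plan planS) ->; case: planS => S_ge0 _ _ _.
by do 2!apply: sumr_ge0 => ? _.
Qed.

Lemma sum_setUI (K : finType) (f : K -> R) (C D : {set K}) :
  \sum_(k in C :|: D) f k + \sum_(k in C :&: D) f k
    = \sum_(k in C) f k + \sum_(k in D) f k.
Proof.
rewrite !(big_mkcond (fun k => k \in _)) -!big_split /=.
apply: eq_bigr => k _; rewrite !inE.
by case: (k \in C); case: (k \in D); rewrite /= ?addr0 ?add0r.
Qed.

Lemma slack_modular a b A B A' B' :
  slack a b (A :|: A') (B :&: B') + slack a b (A :&: A') (B :|: B')
    = slack a b A B + slack a b A' B'.
Proof.
rewrite /slack finset.setCI finset.setCU.
have := sum_setUI a A A'; have := sum_setUI b (~: B) (~: B').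
lra.
Qed.

(** Every cut with [(i0, j0)] in [~: A] x [~: B] bounds the mass that a plan can
put on the edge [(i0, j0)], by [slack_plan]; this is the best of these bounds. *)
Definition tightest_cut E a b i0 j0 A B : Prop :=
  [/\ edgeless E A B, i0 \notin A, j0 \notin B
    & forall A' B', edgeless E A' B' -> i0 \notin A' -> j0 \notin B' ->
        slack a b A B <= slack a b A' B'].

Lemma tightest_cut_exists E a b i0 j0 :
  exists A B, tightest_cut E a b i0 j0 A B.
Proof.
pose P (AB : {set I} * {set J}) :=
  [&& edgeless E AB.1 AB.2, i0 \notin AB.1 & j0 \notin AB.2].
have P0 : P (finset.set0, finset.set0).
  rewrite /P !inE !andbT; apply/edgelessP => i j; by rewrite inE.
case: (arg_minP (fun AB => slack a b AB.1 AB.2) P0) => -[A B] /and3P[/= ? ? ?] H.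
exists A, B; split=> // A' B' ? ? ?.
by apply: (H (A', B')); apply/and3P.
Qed.

Definition decrease (K : eqType) (k0 : K) (t : R) (f : K -> R) : K -> R :=
  fun k => f k - t *+ (k == k0).

Lemma sum_decrease (K : finType) (k0 : K) t (f : K -> R) (P : pred K) :
  \sum_(k | P k) decrease k0 t f k = \sum_(k | P k) f k - t *+ P k0.
Proof.
rewrite /decrease big_split /= sumrN; congr (_ - _).
case: (boolP (P k0)) => Pk0.
  by rewrite (bigD1 k0) //= eqxx big1 ?addr0 // => k /andP[_ /negPf ->].
by rewrite big1 // => k Pk; case: eqP Pk Pk0 => // -> ->.
Qed.

Lemma slack_decrease a b i0 j0 t A B :
  slack (decrease i0 t a) (decrease j0 t b) A B
    = slack a b A B + t *+ (i0 \in A) - t *+ (j0 \notin B).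
Proof. by rewrite /slack !sum_decrease inE; lra. Qed.

(** Deleting the edge creates new edgeless pairs [(A, B)], those with [i0] in [A]
and [j0] in [B], whose slack grows by [t].  They are handled by uncrossing
with the tightest cut: the union-intersection pairs of the two avoid the edge,
hence were already edgeless, and by modularity their slacks add up to the slack
of [(A, B)] plus [t].  Minimality of [t] serves for the pairs whose slack
decreases. *)
Lemma cut_condition_peel E a b i0 j0 A0 B0 :
    tightest_cut E a b i0 j0 A0 B0 -> cut_condition E a b ->
  let t := slack a b A0 B0 in
  cut_condition (E :\ (i0, j0)) (decrease i0 t a) (decrease j0 t b).
Proof.
move=> [nE0 i0A0 j0B0 tight] cut t A B /edgelessP nAB.
rewrite slack_decrease.
have nE i j : i \in A -> j \in B -> (i, j) != (i0, j0) -> (i, j) \notin E.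
  by move=> iA jB ne; have := nAB i j iA jB; rewrite !inE negb_and ne.
have nAB_E : (i0 \notin A) || (j0 \notin B) -> edgeless E A B.
  move=> ninAB; apply/edgelessP => i j iA jB; apply: nE => //.
  apply: contraL ninAB => /eqP[<- <-]; by rewrite iA jB.
case: (boolP (i0 \in A)) => i0A; case: (boolP (j0 \in B)) => j0B;
  rewrite /= ?mulr1n ?mulr0n ?subr0 ?addr0 ?addrK.
- have U : edgeless E (A :|: A0) (B :&: B0).
    apply/edgelessP => i j; rewrite !inE => /orP[iA|iA] /andP[jB jB'].
      apply: nE => //; apply: contraNneq j0B0 => -[_ <-] //.
    by move/edgelessP: nE0; apply.
  have V : edgeless E (A :&: A0) (B :|: B0).
    apply/edgelessP => i j; rewrite !inE => /andP[iA iA'] /orP[jB|jB].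
      apply: nE => //; apply: contraNneq i0A0 => -[<- _] //.
    by move/edgelessP: nE0; apply.
  by rewrite /t -slack_modular addr_ge0 ?cut.
- by apply/cut/nAB_E; rewrite j0B orbT.
- by apply/cut/nAB_E; rewrite i0A.
- by rewrite subr_ge0; apply: tight => //; apply/nAB_E; rewrite i0A.
Qed.

Lemma plan_peel E a b i0 j0 t S : (i0, j0) \in E -> 0 <= t ->
    plan (E :\ (i0, j0)) (decrease i0 t a) (decrease j0 t b) S ->
  plan E a b (fun i j => S i j + t *+ ((i, j) == (i0, j0))).
Proof.
move=> ijE t0 [S_ge0 SE Sa Sb]; split=> [i j|i j ijNE|i|j].
- by rewrite addr_ge0 ?mulrn_wge0.
- rewrite SE ?(inE, negb_and, ijNE, orbT) //.
  by case: eqP ijNE => [->|]; rewrite ?ijE // add0r.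
- rewrite big_split /= Sa /decrease.
  under [X in _ + X]eq_bigr do rewrite xpair_eqE.
  case: (i == i0) => /=; last by rewrite big1 ?subr0 ?addr0.
  by rewrite (bigD1 j0) //= eqxx big1 ?addr0 ?subrK // => j /negPf ->.
- rewrite big_split /= Sb /decrease.
  under [X in _ + X]eq_bigr do rewrite xpair_eqE andbC.
  case: (j == j0) => /=; last by rewrite big1 ?subr0 ?addr0.
  by rewrite (bigD1 i0) //= eqxx big1 ?addr0 ?subrK // => i /negPf ->.
Qed.

Lemma edgeless0l E B : edgeless E finset.set0 B.
Proof. by apply/edgelessP => i j; rewrite inE. Qed.

Lemma edgeless0r E A : edgeless E A finset.set0.
Proof. by apply/edgelessP => i j _; rewrite inE. Qed.

Lemma slack0l a b B : slack a b finset.set0 B = \sum_(j in ~: B) b j.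
Proof. by rewrite /slack big_set0 subr0. Qed.

Lemma slack0r a b A : \sum_i a i = \sum_j b j ->
  slack a b A finset.set0 = \sum_(i in ~: A) a i.
Proof.
move=> ab; rewrite /slack finset.setC0.
under eq_bigl do rewrite inE.
rewrite -ab (bigID (mem A)) /= addrAC subrr add0r.
by apply: eq_bigl => i; rewrite inE.
Qed.

(** Induction on the number of edges: any edge may be peeled off, and once no edge
is left the cut condition forces both margins to be zero. *)
Lemma plan_exists E a b : \sum_i a i = \sum_j b j -> cut_condition E a b ->
  exists S, plan E a b S.
Proof.
move: {2}#|E| (erefl #|E|) => n; elim: n E a b => [|n IHn] E a b.
  move=> /eqP; rewrite cards_eq0 => /eqP -> ab cut.
  (* The slack of (~: {i}, empty) is a i and that of (empty, ~: {j}) is b j;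
     the slack of the full pair is minus the total mass. *)
  have a_ge0 i : 0 <= a i.
    have := cut _ _ (edgeless0r _ (~: [set i])).
    by rewrite slack0r // finset.setCK big_set1.
  have b_ge0 j : 0 <= b j.
    have := cut _ _ (edgeless0l _ (~: [set j])).
    by rewrite slack0l finset.setCK big_set1.
  have sum_a : \sum_i a i = 0.
    apply/eqP; rewrite eq_le sumr_ge0 ?andbT // -oppr_ge0.
    have /cut : edgeless finset.set0 [set: I] [set: J].
      by apply/edgelessP => i j _ _; rewrite inE.
    rewrite /slack finset.setCT big_set0 sub0r.
    by under eq_bigl do rewrite inE.
  have sum_b : \sum_j b j = 0 by rewrite -ab.
  exists (fun _ _ => 0); split=> // [i|j]; rewrite big1 //; apply/esym.
    exact: (psumr_eq0P _ sum_a).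
  exact: (psumr_eq0P _ sum_b).
move=> En ab cut.
have /card_gt0P[[i0 j0] ijE] : (0 < #|E|)%N by rewrite En.
have [A0 [B0 tight]] := tightest_cut_exists E a b i0 j0.
have t_ge0 : 0 <= slack a b A0 B0 by case: tight => ? _ _ _; exact: cut.
have [||S planS] := IHn _ _ _ _ _ (cut_condition_peel tight cut).
- by move: En; rewrite (cardsD1 (i0, j0)) ijE => -[].
- by rewrite !sum_decrease ab.
by exists (fun i j => S i j + slack a b A0 B0 *+ ((i, j) == (i0, j0)));
  exact: plan_peel planS.
Qed.

(** Any edge may be peeled first, and it keeps the mass it receives then. *)
Lemma plan_charging E a b i0 j0 :
    \sum_i a i = \sum_j b j -> cut_condition E a b -> (i0, j0) \in E ->
  exists A B S, [/\ edgeless E A B, i0 \notin A, j0 \notin B, plan E a b S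
                  & slack a b A B <= S i0 j0].
Proof.
move=> ab cut ijE; have [A [B tight]] := tightest_cut_exists E a b i0 j0.
have [nAB i0A j0B _] := tight.
have t_ge0 : 0 <= slack a b A B by exact: cut.
have [|S planS] := plan_exists _ (cut_condition_peel tight cut).
  by rewrite !sum_decrease ab.
exists A, B, (fun i j => S i j + slack a b A B *+ ((i, j) == (i0, j0))).
split=> //; first exact: plan_peel planS.
by rewrite eqxx lerDr; case: planS.
Qed.

End Plans.

(** * Matrices supported in that of a given matrix *)

Section Supports.
Context {R : realType} {p q : nat}.
Variables (a : 'rV[R]_p) (b : 'rV[R]_q) (X0 : 'M[R]_(p, q)).
Hypothesis X0_ge0 : nonneg_mx X0.
Implicit Types (S : 'M[R]_(p, q)) (A : {set 'I_p}) (B : {set 'I_q}).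

Lemma null_onE A B : null_on X0 A B = edgeless (Supp X0) A B.
Proof.
apply: eq_forallb_in => i _; apply: eq_forallb_in => j _.
by rewrite inE /= lt_neqAle X0_ge0 andbT negbK eq_sym.
Qed.

Lemma GammaS_plan S :
  GammaS a b X0 S <-> plan (Supp X0) (a 0) (b 0) S.
Proof.
split=> [[[S_ge0 Sa Sb] /fintype.subsetP SX]|[S_ge0 SX Sa Sb]].
  split=> // i j; apply: contraNeq => Sij; apply: SX.
  by rewrite inE /= lt_neqAle eq_sym Sij S_ge0.
split; first by split.
apply/fintype.subsetP => -[i j]; rewrite inE /=; apply: contraLR => /SX ->.
by rewrite ltxx.
Qed.

Lemma GammaS_of_plan (s : 'I_p -> 'I_q -> R) :
  plan (Supp X0) (a 0) (b 0) s -> GammaS a b X0 (\matrix_(i, j) s i j).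
Proof.
move=> [s_ge0 sX sa sb]; apply/GammaS_plan; split=> [i j|i j|i|j].
- by rewrite mxE.
- by rewrite mxE; exact: sX.
- by under eq_bigr do rewrite mxE.
- by under eq_bigr do rewrite mxE.
Qed.

Lemma GammaS_midpoint S T : GammaS a b X0 S -> GammaS a b X0 T ->
  exists2 M, GammaS a b X0 M & Supp M = Supp S :|: Supp T.
Proof.
move=> /GammaS_plan[S_ge0 SX Sa Sb] /GammaS_plan[T_ge0 TX Ta Tb].
exists (2^-1 *: (S + T)).
  apply/GammaS_plan; split=> [i j|i j ijX|i|j].
  - by rewrite !mxE mulr_ge0 ?addr_ge0 ?invr_ge0.
  - by rewrite !mxE SX ?TX // addr0 mulr0.
  - under eq_bigr do rewrite !mxE.
    by rewrite -mulr_sumr big_split /= Sa Ta; lra.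
  - under eq_bigr do rewrite !mxE.
    by rewrite -mulr_sumr big_split /= Sb Tb; lra.
apply/setP => -[i j]; rewrite !inE /= !mxE pmulr_rgt0 ?invr_gt0 //.
have := S_ge0 i j; have := T_ge0 i j; rewrite !le0r.
by move=> /orP[/eqP ->|T0] /orP[/eqP ->|S0];
  rewrite ?addr0 ?add0r ?ltxx ?S0 ?T0 ?addr_gt0 ?orbT.
Qed.

(** A matrix with the largest number of positive entries has the largest
support, since its midpoint with any other one cannot have more. *)
Lemma max_support_exists S : GammaS a b X0 S ->
  exists S0, max_support a b X0 S0.
Proof.
move=> GS.
pose P n := `[< exists2 T, GammaS a b X0 T & #|Supp T| = n >].
have exP : exists n, P n by exists #|Supp S|; apply/asboolP; exists S.
have ubP n : P n -> (n <= #|{: 'I_p * 'I_q}|)%N.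
  by move=> /asboolP[T _ <-]; exact: max_card.
case: (ex_maxnP exP ubP) => n /asboolP[S0 GS0 <-] maxS0.
exists S0; split=> // T GT; have [M GM suppM] := GammaS_midpoint GS0 GT.
have /eqP -> : Supp S0 == Supp M.
  rewrite finset.eqEcard suppM finset.subsetUl -suppM maxS0 //.
  by apply/asboolP; exists M.
by rewrite suppM finset.subsetUr.
Qed.

Lemma criticalE A B :
  critical a b X0 A B = [&& A != finset.set0, B != finset.set0,
    edgeless (Supp X0) A B & slack (a 0) (b 0) A B == 0].
Proof.
by rewrite /critical /slack null_onE subr_eq0 (eq_sym (\sum_(j in ~: B) b 0 j)).
Qed.

(** The mass of [S] on [~: A] x [~: B] is the slack of the cut, here zero. *)
Lemma critical_Supp S A B i j : GammaS a b X0 S -> critical a b X0 A B ->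
  i \notin A -> j \notin B -> (i, j) \notin Supp S.
Proof.
rewrite criticalE => /GammaS_plan planS /and4P[_ _ nAB sl0] iA jB.
have [S_ge0 _ _ _] := planS; move: sl0; rewrite (slack_plan planS nAB).
rewrite psumr_eq0 => [/allP/(_ i)|? _]; last exact: sumr_ge0.
rewrite mem_index_enum inE iA => /(_ isT)/= .
rewrite psumr_eq0 // => /allP/(_ j); rewrite mem_index_enum inE jB.
by move=> /(_ isT)/eqP Sij; rewrite inE /= Sij ltxx.
Qed.

(** If the tightest cut for the edge [(i, j)] has positive slack, this slack can
be put on the edge; otherwise that cut is critical, since for an empty [A] the
slack is at least [b j], and for an empty [B] it is at least [a i]. *)
Lemma Supp_critical i j :
    (forall i, 0 < a 0 i) -> (forall j, 0 < b 0 j) ->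
    \sum_i a 0 i = \sum_j b 0 j -> (exists T, GammaS a b X0 T) ->
    (i, j) \in Supp X0 ->
  (exists2 S, GammaS a b X0 S & (i, j) \in Supp S) \/
  (exists A B, [/\ critical a b X0 A B, i \notin A & j \notin B]).
Proof.
move=> a_gt0 b_gt0 ab [T /GammaS_plan/slack_ge0 cut] ijX.
have [A [B [s [nAB iA jB planS sl_le]]]] := plan_charging ab cut ijX.
have := cut _ _ nAB; rewrite le0r => /orP[/eqP sl0|sl_gt0]; [right|left].
  exists A, B; split=> //; rewrite criticalE nAB sl0 eqxx !andbT.
  apply/andP; split; apply: contra_eq_neq sl0 => ->; rewrite gt_eqF //.
    rewrite slack0l (bigD1 j) ?inE //= ltr_wpDr ?b_gt0 //.
    by apply: sumr_ge0 => ? _; exact/ltW.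
  rewrite slack0r // (bigD1 i) ?inE //= ltr_wpDr ?a_gt0 //.
  by apply: sumr_ge0 => ? _; exact/ltW.
exists (\matrix_(i, j) s i j); first exact: GammaS_of_plan.
by rewrite inE /= mxE (lt_le_trans sl_gt0).
Qed.

End Supports.

Theorem theorem1 (R : realType) (p q : nat) (hp : (2 <= p)%N) (hq : (2 <= q)%N)
    (a : 'rV[R]_p) (b : 'rV[R]_q)
    (ha : forall i, 0 < a 0 i) (hb : forall j, 0 < b 0 j)
    (ha1 : \sum_(i < p) a 0 i = 1) (hb1 : \sum_(j < q) b 0 j = 1)
    (X0 : 'M[R]_(p, q)) (hX0 : nonneg_mx X0)
    (hrow : forall i, exists j, 0 < X0 i j)
    (hcol : forall j, exists i, 0 < X0 i j) :
  (GammaS a b X0 = set0%classic <->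
     exists (A : {set 'I_p}) (B : {set 'I_q}),
       null_on X0 A B /\ \sum_(j in ~: B) b 0 j < \sum_(i in A) a 0 i)
  /\
  (GammaS a b X0 <> set0%classic ->
     (exists S0 : 'M[R]_(p, q), max_support a b X0 S0)
     /\
     forall S0 : 'M[R]_(p, q), max_support a b X0 S0 ->
       (Supp S0 \proper Supp X0 <->
          exists (A : {set 'I_p}) (B : {set 'I_q}),
            critical a b X0 A B /\ ~~ null_on X0 (~: A) (~: B))
       /\
       Supp S0 = Supp X0 :\:
         \bigcup_(AB : {set 'I_p} * {set 'I_q} | critical a b X0 AB.1 AB.2)
            finset.setX (~: AB.1) (~: AB.2)).
Proof.
have ab : \sum_i a 0 i = \sum_j b 0 j by rewrite ha1 hb1.
split.
  split=> [G0|[A [B [nAB ltba]]]].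
    apply: contrapT => nocut.
    have cut : cut_condition (Supp X0) (a 0) (b 0).
      move=> A B nAB; rewrite subr_ge0 leNgt; apply/negP => ltba.
      by apply: nocut; exists A, B; rewrite null_onE.
    have [s /GammaS_of_plan] := plan_exists ab cut.
    by rewrite G0.
  apply/seteqP; split=> // S /GammaS_plan/slack_ge0/(_ A B).
  rewrite -null_onE // => /(_ nAB).
  by rewrite subr_ge0 leNgt ltba.
move=> /eqP/set0P[S GS]; split; first exact: max_support_exists GS.
move=> S0 [GS0 maxS0].
have suppE : Supp S0 = Supp X0 :\:
    \bigcup_(AB : {set 'I_p} * {set 'I_q} | critical a b X0 AB.1 AB.2)
       finset.setX (~: AB.1) (~: AB.2).
  apply/setP => -[i j]; rewrite finset.in_setD; apply/idP/andP => [ijS0|[ncrit ijX]].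
    split; last by case: GS0 => _ /fintype.subsetP; apply.
    apply/negP => /bigcupP[[A B] /= crit]; rewrite !inE => /andP[iA jB].
    by have /negP := critical_Supp hX0 GS0 crit iA jB.
  have [|[T GT ijT]|[A [B [crit iA jB]]]] := Supp_critical hX0 ha hb ab _ ijX.
  - by exists S.
  - exact: (fintype.subsetP (maxS0 _ GT)).
  - case/negP: ncrit; apply/bigcupP; exists (A, B) => //.
    by rewrite !inE; apply/andP.
split=> //; split=> [/properP[_ [[i j] ijX]]|[A [B [crit]]]].
  rewrite suppE finset.in_setD ijX andbT negbK => /bigcupP[[A B] /= crit].
  rewrite !inE /= => /andP[iA jB]; exists A, B; split=> //.
  rewrite null_onE //; apply/negP => /edgelessP/(_ i j).
  by rewrite !finset.in_setC ijX iA jB => /(_ isT isT).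
move=> /forall_inPn[i iA /forall_inPn[j jB Xij]].
apply/properP; split; first by case: GS0.
exists (i, j); first by rewrite inE /= lt_neqAle eq_sym Xij hX0.
by apply: critical_Supp GS0 crit _ _; rewrite // -finset.in_setC.
Qed.
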